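(* Let $F$ be a field containing $\mathbb{F}_q$, equipped with a discrete non-archimedean valuation $\nu:F\to\mathbb{Z}\cup\{\infty\}$ with $\nu(F^* )=\mathbb{Z}$. Let $f,g\in F\{\tau\}$ be normalized polynomials. Let $d$ and $\ell$ denote their normalized GCD and LCM in $F\{\tau\}$, respectively. Then, for all $z\in\mathbb{R}$, $$\mathbf{V}^\nu_d(z)+\mathbf{V}^\nu_\ell(z)\leqslant\mathbf{V}^\nu_f(z)+\mathbf{V}^\nu_g(z).$$
   Context: $F\{\tau\}$ is the ring of twisted polynomials $\sum_i f_i\tau^i$ ($f_i\in F$) with $\tau c=c^q\tau$ for $c\in F$. A polynomial $f=\sum_{i=0}^d f_i\tau^i\in F\{\tau\}$ is normalized if its constant coefficient $f_0$ equals $1$. Every left ideal of $F\{\tau\}$ is principal. For $f,g\in F\{\tau\}$ with nonzero constant coefficients, their (right) GCD is the unique normalized generator of the left ideal $F\{\tau\}\cdot f+F\{\tau\}\cdot g$, and their (right) LCM is the unique normalized generator of the left ideal $F\{\tau\}\cdot f\cap F\{\tau\}\cdot g$. For $f=\sum_{i=0}^d f_i\tau^i\in F\{\tau\}$ with $f_0\ne0$ and $z\in\mathbb{R}$, set $\mathbf{V}^\nu_f(z)=\min\{\nu(f_i)+q^i z:0\leqslant i\leqslant d\}$. *)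

(* Defs.v *)
From HB Require Import structures.
From mathcomp Require Import all_boot all_order all_algebra all_field.
From mathcomp Require Import classical_sets reals constructive_ereal.

Set Implicit Arguments.
Unset Strict Implicit.
Unset Printing Implicit Defensive.

Import Order.TTheory GRing.Theory Num.Theory.
Local Open Scope ring_scope.

(* The inclusion of F_q in F is a ring morphism iota : K -> F from a finite
   field K, and q = #|K|.  The ring F{tau} is the additive group of {poly F},
   with 'X^i standing for tau^i, under the multiplication determined by
   tau * c = c ^+ q * tau.  Since tpoly iota is convertible to {poly F}, the
   type ascription decides which of the two products is meant.               *)
Definition tpoly (K : finFieldType) (F : fieldType)
  (iota : {rmorphism K -> F}) : Type := {poly F}.

HB.instance Definition _ (K : finFieldType) (F : fieldType)
    (iota : {rmorphism K -> F}) :=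
  GRing.Zmodule.copy (tpoly iota) {poly F}.

Section TwistedRing.
Variables (K : finFieldType) (F : fieldType) (iota : {rmorphism K -> F}).
Implicit Types f g h : tpoly iota.

Definition tcoef f (i : nat) : F := (f : {poly F})`_i.

Definition tpoly_size f : nat := size (f : {poly F}).

Definition tconst (c : F) : tpoly iota := c%:P.

Definition tau : tpoly iota := 'X.

Definition tmul f g : tpoly iota :=
  \poly_(n < (tpoly_size f + tpoly_size g).-1)
    \sum_(i < n.+1) tcoef f i * tcoef g (n - i) ^+ (#|K| ^ i).

Lemma expr_cardX_add (n : nat) (x y : F) :
  (x + y) ^+ (#|K| ^ n) = x ^+ (#|K| ^ n) + y ^+ (#|K| ^ n).
Proof.
have [p p_pr pK] := finPcharP K.
have pF : p \in [pchar F] by rewrite (rmorph_pchar iota).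
apply: exprDn_pchar; rewrite (eq_pnat _ (pcharf_eq pF)) pnatX; apply/orP; left.
by rewrite (card_pprimeChar pK) pnatX pnat_id.
Qed.

Lemma expr_cardX_0 (n : nat) : 0 ^+ (#|K| ^ n) = 0 :> F.
Proof. by rewrite expr0n expn_eq0 -leqn0 leqNgt (ltnW (card_finNzRing_gt1 K)). Qed.

Lemma expr_cardX_sum (n : nat) (I : Type) (r : seq I) (P : pred I) (E : I -> F) :
  (\sum_(i <- r | P i) E i) ^+ (#|K| ^ n)
    = \sum_(i <- r | P i) E i ^+ (#|K| ^ n).
Proof.
apply: (big_morph (fun x : F => x ^+ (#|K| ^ n))); last exact: expr_cardX_0.
exact: expr_cardX_add.
Qed.

Lemma tcoefP f g : (forall i, tcoef f i = tcoef g i) <-> f = g.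
Proof. by split=> [fg|->//]; apply/(@polyP F). Qed.

Lemma tcoefD f g i : tcoef (f + g) i = tcoef f i + tcoef g i.
Proof. exact: (@coefD F). Qed.

Lemma tcoef_mul f g n :
  tcoef (tmul f g) n
    = \sum_(i < n.+1) tcoef f i * tcoef g (n - i) ^+ (#|K| ^ i).
Proof.
rewrite /tcoef /tmul coef_poly ltn_predRL; case: leqP => // le_fg_n1.
rewrite big1 // => j _; have [lf_j|lt_j_f] := leqP (tpoly_size f) j.
  by rewrite /tcoef nth_default ?mul0r.
rewrite /tcoef [(g : {poly F})`__]nth_default ?expr_cardX_0 ?mulr0 //.
rewrite leq_subRL -ltnS // (leq_trans _ le_fg_n1) //.
by rewrite /tpoly_size ltn_add2r.
Qed.

Lemma tcoef_mul_rev f g n :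
  tcoef (tmul f g) n
    = \sum_(i < n.+1) tcoef f (n - i) * tcoef g i ^+ (#|K| ^ (n - i)).
Proof.
rewrite tcoef_mul (reindex_inj rev_ord_inj) /=.
by apply: eq_bigr => j _; rewrite (sub_ordK j).
Qed.

Lemma tmulA : associative tmul.
Proof.
move=> f g h; apply/tcoefP => i; rewrite tcoef_mul tcoef_mul_rev.
pose coef3 j k := tcoef f j *
  (tcoef g (i - j - k) ^+ (#|K| ^ j) * tcoef h k ^+ (#|K| ^ (i - k))).
transitivity (\sum_(j < i.+1) \sum_(k < i.+1 | (k <= i - j)%N) coef3 j k).
  apply: eq_bigr => /= j _.
  rewrite tcoef_mul_rev expr_cardX_sum big_distrr /=.
  rewrite (big_ord_narrow_leq (leq_subr _ _)); apply: eq_bigr => k _ /=.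
  rewrite /coef3 exprMn -exprM -expnD; congr (_ * (_ * _ ^+ (_ ^ _))).
  have k_le : (k <= i - j)%N by rewrite -ltnS ltn_ord.
  rewrite subnAC subnK // leq_subRL; last exact: leq_trans k_le (leq_subr _ _).
  by rewrite addnC -leq_subRL ?leq_ord.
rewrite (exchange_big_dep predT) //=; apply: eq_bigr => k _.
transitivity (\sum_(j < i.+1 | (j <= i - k)%N) coef3 j k).
  apply: eq_bigl => j; rewrite -ltnS -(ltnS j) -!subSn ?leq_ord //.
  by rewrite -subn_gt0 -(subn_gt0 j) -!subnDA addnC.
rewrite (big_ord_narrow_leq (leq_subr _ _)) tcoef_mul big_distrl /=.
by apply: eq_bigr => j _; rewrite /coef3 -!subnDA addnC mulrA.
Qed.

Lemma tmul1 : left_id (tconst 1) tmul.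
Proof.
move=> f; apply/tcoefP => i; rewrite tcoef_mul big_ord_recl subn0.
rewrite big1 => [|j _]; rewrite /tcoef coefC /= ?mul0r //.
by rewrite mul1r addr0 expn0 expr1.
Qed.

Lemma tmulr1 : right_id (tconst 1) tmul.
Proof.
move=> f; apply/tcoefP => i; rewrite tcoef_mul_rev big_ord_recl subn0.
rewrite big1 => [|j _]; rewrite /tcoef coefC /= ?expr_cardX_0 ?mulr0 //.
by rewrite expr1n mulr1 addr0.
Qed.

Lemma tmulDl : left_distributive tmul +%R.
Proof.
move=> f g h; apply/tcoefP => i; rewrite tcoefD !tcoef_mul -big_split /=.
by apply: eq_bigr => j _; rewrite tcoefD mulrDl.
Qed.

Lemma tmulDr : right_distributive tmul +%R.
Proof.
move=> f g h; apply/tcoefP => i; rewrite tcoefD !tcoef_mul -big_split /=.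
by apply: eq_bigr => j _; rewrite tcoefD expr_cardX_add mulrDr.
Qed.

Lemma tconst1_neq0 : tconst 1 != 0.
Proof. exact: (oner_neq0 {poly F}). Qed.

HB.instance Definition _ := GRing.Zmodule_isNzRing.Build (tpoly iota)
  tmulA tmul1 tmulr1 tmulDl tmulDr tconst1_neq0.

Lemma tau_tconst (c : F) : tau * tconst c = tconst (c ^+ #|K|) * tau.
Proof.
apply/tcoefP => i; rewrite [LHS]tcoef_mul [RHS]tcoef_mul_rev.
apply: eq_bigr => j _; rewrite /tcoef /= coefX !coefC.
have [->|nj1] := eqVneq (j : nat) 1%N; last by rewrite mul0r expr_cardX_0 mulr0.
by rewrite mul1r expr1n mulr1 expn1; case: eqP => // _; rewrite (expr_cardX_0 1).
Qed.

Lemma tpolyE f : f = \sum_(i < tpoly_size f) tconst (tcoef f i) * tau ^+ i.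
Proof.
have tauX n : tau ^+ n = ('X^n : {poly F}) :> tpoly iota.
  elim: n => [//|n IHn]; rewrite exprSr IHn; apply/tcoefP => i.
  rewrite [LHS]tcoef_mul_rev /tcoef exprSr [in RHS]coefMr.
  by apply: eq_bigr => j _; rewrite coefX; case: eqP => _;
    rewrite ?expr1n ?expr_cardX_0.
rewrite -[LHS](@coefK F); rewrite poly_def; apply: eq_bigr => i _.
rewrite tauX -mul_polyC; apply/tcoefP => n.
rewrite [RHS]tcoef_mul /tcoef [in LHS]coefM; apply: eq_bigr => j _.
rewrite !coefC; case: eqP => [->|_]; last by rewrite !mul0r.
by rewrite expn0 expr1.
Qed.

Definition normalized f : Prop := tcoef f 0 = 1.

Local Open Scope classical_set_scope.

Definition left_ideal f : set (tpoly iota) := [set a * f | a in setT].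

Definition left_ideal_sum (I J : set (tpoly iota)) : set (tpoly iota) :=
  [set a + b | a in I & b in J].

Definition is_gcd f g d : Prop :=
  normalized d /\ left_ideal d = left_ideal_sum (left_ideal f) (left_ideal g).

Definition is_lcm f g l : Prop :=
  normalized l /\ left_ideal l = left_ideal f `&` left_ideal g.

End TwistedRing.

(* \bar int also contains -oo, which is excluded by the first field. *)
Record discrete_valuation (F : fieldType) (nu : F -> \bar int) : Prop := {
  dv_neqNy : forall x, nu x <> -oo%E;
  dv_eqy : forall x, nu x = +oo%E <-> x = 0;
  dv_mul : forall x y, nu (x * y) = (nu x + nu y)%E;
  dv_add : forall x y, (Order.min (nu x) (nu y) <= nu (x + y)%R)%E;
  dv_surj : forall n : int, exists x, nu x = (n%:E)%E }.

(* Zero coefficients contribute the neutral element +oo, so the value is a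
   real number as soon as f has a nonzero coefficient.                       *)
Definition Vmin (R : realType) (K : finFieldType) (F : fieldType)
    (iota : {rmorphism K -> F}) (nu : F -> \bar int) (f : tpoly iota) (z : R) :
    \bar R :=
  (\big[Order.min/+oo]_(i < tpoly_size f)
     (er_map (intr : int -> R) (nu (tcoef f i)) + (#|K|%:R ^+ i * z)%R%:E))%E.

(* Main.v *)
(* Twisted multiplication is composition of q-linear polynomials, so
   V_(fg) = V_f o V_g, and the largest indices realizing the minima add up.  This
   reduces the claim to coprime f, g, with u f + v g = 1 and l = a g = b f.

   Write m_f(z) for the largest index realizing V_f(z), so that q^(m_f(z)) is the
   left slope of V_f at z.  Multiplication by v takes F{tau}/F{tau}f into
   F{tau}/F{tau}a.  Weierstrass division by f on a disc (by a on its image) leaves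
   remainders of degree less than m_f(z) (resp. m_a(V_g(z))), up to an error as
   small as desired, so if m_a(V_g(z)) < m_f(z), a linear dependence
   between the remainders of the tau^i v, i < m_f(z), gives a nonzero polynomial
   of degree less than m_f(z) that is almost a multiple of f, which is absurd.
   Hence m_l(z) = m_a(V_g(z)) + m_g(z) >= m_f(z) + m_g(z).

   As q^(m+n) >= q^m + q^n - 1, the function V_f + V_g - V_l - z is nonincreasing,
   and it vanishes for large z, where all the V's equal z. *)
Require Import Defs.
From mathcomp Require Import all_boot all_order all_algebra all_field.
From mathcomp Require Import classical_sets reals constructive_ereal.
From mathcomp Require Import zify ring lra.

Set Implicit Arguments.
Unset Strict Implicit.
Unset Printing Implicit Defensive.

Import Order.TTheory GRing.Theory Num.Theory.
Local Open Scope ring_scope.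

(** * Valuations with real values *)

Section RealValuation.
Variables (R : realType) (F : fieldType).

(** The laws avoid 0, since a real-valued [w] cannot be infinite there; [vge] and [vgt] restore that
    infinity through the disjunct [x == 0]. *)
Record real_valuation (w : F -> R) : Prop := {
  wM : forall x y, x != 0 -> y != 0 -> w (x * y) = w x + w y;
  wD : forall x y, x != 0 -> y != 0 -> x + y != 0 ->
    Num.min (w x) (w y) <= w (x + y) }.

Variables (w : F -> R) (wP : real_valuation w).

Definition vge (x : F) (c : R) : bool := (x == 0) || (c <= w x).
Definition vgt (x : F) (c : R) : bool := (x == 0) || (c < w x).

Lemma w1 : w 1 = 0.
Proof.
have := wM wP (oner_neq0 F) (oner_neq0 F); rewrite mulr1 => /eqP.
by rewrite -subr_eq0 opprD addrA subrr sub0r oppr_eq0 => /eqP.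
Qed.

Lemma wN x : w (- x) = w x.
Proof.
have [->|x0] := eqVneq x 0; first by rewrite oppr0.
have n1 : -1 != 0 :> F by rewrite oppr_eq0 oner_neq0.
have := wM wP n1 n1; rewrite mulrNN mulr1 w1 => e.
by rewrite -mulN1r (wM wP) //; lra.
Qed.

Lemma wX x n : x != 0 -> w (x ^+ n) = n%:R * w x.
Proof.
move=> x0; elim: n => [|n IHn]; first by rewrite expr0 w1 mul0r.
by rewrite exprS (wM wP) ?expf_neq0 // IHn -addn1 natrD; lra.
Qed.

Lemma vge0 c : vge 0 c. Proof. by rewrite /vge eqxx. Qed.
Lemma vgt0 c : vgt 0 c. Proof. by rewrite /vgt eqxx. Qed.

Lemma vge_le x a b : b <= a -> vge x a -> vge x b.
Proof.
by move=> ba /orP[/eqP->|h]; rewrite /vge ?eqxx ?(le_trans ba h) ?orbT.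
Qed.

Lemma vgeN x c : vge (- x) c = vge x c.
Proof. by rewrite /vge oppr_eq0 wN. Qed.

Lemma vgeD x y c : vge x c -> vge y c -> vge (x + y) c.
Proof.
rewrite /vge; have [->|x0] /= := eqVneq x 0; first by rewrite add0r.
have [->|y0] /= := eqVneq y 0; first by rewrite addr0 (negPf x0).
have [//|xy0] /= := eqVneq (x + y) 0; move=> hx hy.
by apply: le_trans (wD wP x0 y0 xy0); rewrite le_min hx.
Qed.

Lemma vgtD x y c : vgt x c -> vgt y c -> vgt (x + y) c.
Proof.
rewrite /vgt; have [->|x0] /= := eqVneq x 0; first by rewrite add0r.
have [->|y0] /= := eqVneq y 0; first by rewrite addr0 (negPf x0).
have [//|xy0] /= := eqVneq (x + y) 0; move=> hx hy.
by apply: lt_le_trans (wD wP x0 y0 xy0); rewrite lt_min hx.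
Qed.

Lemma vge_sum I (r : seq I) (P : pred I) (G : I -> F) c :
  (forall i, P i -> vge (G i) c) -> vge (\sum_(i <- r | P i) G i) c.
Proof.
move=> h; apply: (big_ind (vge^~ c)) => //; first exact: vge0.
by move=> x y; apply: vgeD.
Qed.

Lemma vgt_sum I (r : seq I) (P : pred I) (G : I -> F) c :
  (forall i, P i -> vgt (G i) c) -> vgt (\sum_(i <- r | P i) G i) c.
Proof.
move=> h; apply: (big_ind (vgt^~ c)) => //; first exact: vgt0.
by move=> x y; apply: vgtD.
Qed.

Lemma vgeM x y a b : vge x a -> vge y b -> vge (x * y) (a + b).
Proof.
rewrite /vge mulf_eq0; have [//|x0] /= := eqVneq x 0.
by have [//|y0] /= := eqVneq y 0; rewrite (wM wP) //; apply: lerD.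
Qed.

Lemma vgt_geM x y a b : vgt x a -> vge y b -> vgt (x * y) (a + b).
Proof.
rewrite /vge /vgt mulf_eq0; have [//|x0] /= := eqVneq x 0.
by have [//|y0] /= := eqVneq y 0; rewrite (wM wP) //; apply: ltr_leD.
Qed.

Lemma vge_gtM x y a b : vge x a -> vgt y b -> vgt (x * y) (a + b).
Proof. by move=> hx hy; rewrite mulrC addrC; apply: vgt_geM. Qed.

Lemma vgeX x a n : (0 < n)%N -> vge x a -> vge (x ^+ n) (n%:R * a).
Proof.
move=> n0; rewrite /vge expf_eq0 n0; have [//|x0] /= := eqVneq x 0.
by rewrite wX // => h; rewrite ler_wpM2l.
Qed.

Lemma vgtX x a n : (0 < n)%N -> vgt x a -> vgt (x ^+ n) (n%:R * a).
Proof.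
move=> n0; rewrite /vgt expf_eq0 n0; have [//|x0] /= := eqVneq x 0.
by rewrite wX // => h; rewrite ltr_pM2l // ltr0n.
Qed.

(** The upper bound on [w (x + y)] comes from the ultrametric inequality for [x = (x + y) - y]. *)
Lemma w_dominant x y c :
  x != 0 -> w x = c -> vgt y c -> x + y != 0 /\ w (x + y) = c.
Proof.
rewrite /vgt => x0 wx; have [->|y0] /= := eqVneq y 0; first by rewrite addr0.
move=> hy; have xy0 : x + y != 0.
  by rewrite addr_eq0; apply: contraTneq hy => e; rewrite -wN -e wx ltxx.
split=> //; have := wD wP x0 y0 xy0.
have xE : x + y + (- y) = x by rewrite addrK.
have := wD wP (x := x + y) (y := - y); rewrite oppr_eq0 xE wN.
move=> /(_ xy0 y0 x0); rewrite !ge_min wx.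
by move=> /orP[h1|h1] /orP[h2|h2]; lra.
Qed.

End RealValuation.

(** * Gauss valuations of twisted polynomials and their multiplicativity *)

Section GaussNorm.
Variables (R : realType) (K : finFieldType) (F : fieldType).
Variables (iota : {rmorphism K -> F}) (w : F -> R) (wP : real_valuation w).
Implicit Types (f g h a b c r u v l : tpoly iota) (z x y s : R) (i j k m n : nat).

Local Notation q i := (#|K|%:R ^+ i : R).

Lemma cardK_gt1 : 1 < #|K|%:R :> R.
Proof. by rewrite ltr1n card_finNzRing_gt1. Qed.

Lemma q_ge1 i : 1 <= q i.
Proof. by rewrite exprn_ege1 // ltW // cardK_gt1. Qed.

Lemma q_gt0 i : 0 < q i.
Proof. exact: lt_le_trans ltr01 (q_ge1 i). Qed.

Lemma cardX_gt0 i : (0 < #|K| ^ i)%N.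
Proof. by rewrite expn_gt0 (ltnW (card_finNzRing_gt1 K)). Qed.

Lemma tcoefB f g i : tcoef (f - g) i = tcoef f i - tcoef g i.
Proof. exact: (@coefB F). Qed.

Lemma tcoefN f i : tcoef (- f) i = - tcoef f i.
Proof. exact: (@coefN F). Qed.

Lemma tcoef0 i : tcoef (0 : tpoly iota) i = 0.
Proof. exact: (@coef0 F). Qed.

Lemma tcoef_sum (I : Type) (s : seq I) (P : pred I) (G : I -> tpoly iota) i :
  tcoef (\sum_(e <- s | P e) G e) i = \sum_(e <- s | P e) tcoef (G e) i.
Proof.
apply: (big_morph (fun f => tcoef f i)); last exact: tcoef0.
by move=> f g; apply: tcoefD.
Qed.

Lemma tcoefM f g n :
  tcoef (f * g) n = \sum_(i < n.+1) tcoef f i * tcoef g (n - i) ^+ (#|K| ^ i).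
Proof. exact: tcoef_mul. Qed.

Lemma tcoef_default f i : (tpoly_size f <= i)%N -> tcoef f i = 0.
Proof. by move=> h; rewrite /tcoef nth_default. Qed.

Definition tmono (c : F) k : tpoly iota := c *: 'X^k : {poly F}.

Lemma tcoef_mono (c : F) k i : tcoef (tmono c k) i = if i == k then c else 0.
Proof.
by rewrite /tcoef coefZ coefXn; case: eqP; rewrite ?mulr1 ?mulr0.
Qed.

Lemma tcoef_monoM (c : F) k f i : (k <= i)%N ->
  tcoef (tmono c k * f) i = c * tcoef f (i - k) ^+ (#|K| ^ k).
Proof.
move=> ki; have ki1 : (k < i.+1)%N by [].
rewrite tcoefM (bigD1 (Ordinal ki1)) //= big1 ?addr0 ?tcoef_mono ?eqxx // => j.
by rewrite -val_eqE /= tcoef_mono => /negPf->; rewrite mul0r.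
Qed.

(* [Vmin nu f z >= c] *)
Definition gauss_ge f z (c : R) : Prop :=
  forall i, vge w (tcoef f i) (c - q i * z).

(* [Vmin nu f z = c], and [m] is the largest index realizing the minimum; [q ^ m]
   is the number of roots of [f] with valuation at least [z]. *)
Record gauss_eq f z (c : R) m : Prop := {
  geq_ge : gauss_ge f z c;
  geq_neq0 : tcoef f m != 0;
  geq_val : w (tcoef f m) = c - q m * z;
  geq_gt : forall i, (m < i)%N -> vgt w (tcoef f i) (c - q i * z) }.

Lemma gauss_ge_le f z (c c' : R) : c' <= c -> gauss_ge f z c -> gauss_ge f z c'.
Proof. by move=> cc' h i; apply: vge_le (h i); lra. Qed.

Lemma gauss_ge0 z (c : R) : gauss_ge 0 z c.
Proof. by move=> i; rewrite tcoef0 vge0. Qed.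

Lemma gauss_geN f z (c : R) : gauss_ge f z c -> gauss_ge (- f) z c.
Proof. by move=> hf i; rewrite tcoefN (vgeN wP); apply: hf. Qed.

Lemma gauss_geD f g z (c : R) :
  gauss_ge f z c -> gauss_ge g z c -> gauss_ge (f + g) z c.
Proof. by move=> hf hg i; rewrite tcoefD; apply: vgeD. Qed.

Lemma gauss_ge_sum (I : Type) (s : seq I) (P : pred I) (G : I -> tpoly iota) z
    (c : R) :
  (forall e : I, P e -> gauss_ge (G e) z c) ->
  gauss_ge (\sum_(e <- s | P e) G e) z c.
Proof. by move=> h k; rewrite tcoef_sum; apply: vge_sum => // e Pe; apply: h. Qed.

(** The term with indices [i] and [n - i] has value at least [(c - q^i x) + q^i (x - q^(n-i) z) = c
    - q^n z]: the Frobenius twist makes the bounds compose. *)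
Lemma gauss_geM f g x z (c : R) :
  gauss_ge f x c -> gauss_ge g z x -> gauss_ge (f * g) z c.
Proof.
move=> hf hg n; rewrite tcoefM; apply: vge_sum => // i _.
have := vgeM wP (hf i) (vgeX wP (cardX_gt0 i) (hg (n - i)%N)).
apply: vge_le; rewrite natrX mulrBr [q i * (q _ * z)]mulrA -exprD subnKC ?leq_ord //.
by lra.
Qed.

Lemma gauss_eq_le f z (c c' : R) m :
  gauss_eq f z c m -> gauss_ge f z c' -> c' <= c.
Proof.
by move=> hf /(_ m) /orP[|]; rewrite ?(negPf (geq_neq0 hf)) ?(geq_val hf) //; lra.
Qed.

Lemma gauss_eq_uniq f z (c c' : R) m m' :
  gauss_eq f z c m -> gauss_eq f z c' m' -> c = c' /\ m = m'.
Proof.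
move=> h h'; have cc' : c = c'.
  by apply/le_anti; rewrite (gauss_eq_le h (geq_ge h')) (gauss_eq_le h' (geq_ge h)).
split=> //; subst c'; wlog lt_mm' : m m' h h' / (m < m')%N.
  by move=> H; case: (ltngtP m m') => // [/H|/H e]; [apply|apply/esym/e].
have := geq_gt h lt_mm'; rewrite /vgt (negPf (geq_neq0 h')) (geq_val h') ltxx.
by [].
Qed.

(** At index [m + n] every pair other than [(m, n)] exceeds [m] on the left or [n] on the right, so
    its term has strictly larger value and cannot cancel the dominant one. Past [m + n] every pair
    does so. *)
Lemma gauss_eqM f g z x (c : R) m n :
  gauss_eq f x c m -> gauss_eq g z x n -> gauss_eq (f * g) z c (m + n).
Proof.
move=> hf hg; have E k (i : 'I_k.+1) (t : R) :
    t - q i * x + (#|K| ^ i)%:R * (x - q (k - i) * z) = t - q k * z.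
  by rewrite natrX mulrBr [q i * (q _ * z)]mulrA -exprD subnKC ?leq_ord //; lra.
have gtM k (i : 'I_k.+1) : (m < i)%N || (n < k - i)%N ->
    vgt w (tcoef f i * tcoef g (k - i) ^+ (#|K| ^ i)) (c - q k * z).
  rewrite -(E k i); case/orP => hi.
    apply: (vgt_geM wP) (geq_gt hf hi) _ => //.
    by apply: (vgeX wP) => //; [apply: cardX_gt0 | apply: (geq_ge hg)].
  apply: (vge_gtM wP) (geq_ge hf i) _ => //.
  by apply: (vgtX wP) => //; [apply: cardX_gt0 | apply: (geq_gt hg)].
have mmn : (m < (m + n).+1)%N by lia.
have [] // := @w_dominant _ _ _ wP (tcoef f m * tcoef g n ^+ (#|K| ^ m))
  (\sum_(i < (m + n).+1 | i != Ordinal mmn)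
    tcoef f i * tcoef g (m + n - i) ^+ (#|K| ^ i)) (c - q (m + n) * z).
- by rewrite mulf_neq0 ?expf_neq0 ?(geq_neq0 hf) ?(geq_neq0 hg).
- rewrite (wM wP) ?expf_neq0 ?(geq_neq0 hf) ?(geq_neq0 hg) //.
  rewrite (wX wP) ?(geq_neq0 hg) // (geq_val hf) (geq_val hg).
  by rewrite -(E _ (Ordinal mmn)) /= addKn.
- apply: vgt_sum => // i; rewrite -val_eqE /= => ne_im; apply: gtM.
  by move: ne_im; lia.
have <- : tcoef (f * g) (m + n) = tcoef f m * tcoef g n ^+ (#|K| ^ m) +
    \sum_(i < (m + n).+1 | i != Ordinal mmn)
      tcoef f i * tcoef g (m + n - i) ^+ (#|K| ^ i).
  by rewrite tcoefM (bigD1 (Ordinal mmn)) //= addKn.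
split=> //; first exact: gauss_geM (geq_ge hf) (geq_ge hg).
move=> k lt_k; rewrite tcoefM; apply: vgt_sum => // i _; apply: gtM; lia.
Qed.

Lemma gauss_eq_exists f z : f != 0 -> exists (c : R) m, gauss_eq f z c m.
Proof.
move=> f0; pose V i : R := w (tcoef f i) + q i * z.
have sz i : tcoef f i != 0 -> (i < tpoly_size f)%N.
  by apply: contraNltn => /tcoef_default ->.
have [i0 fi0] : exists i, tcoef f i != 0.
  by exists (tpoly_size f).-1; rewrite -(lead_coef_eq0 (f : {poly F})) in f0.
(* Minimize over the nonzero coefficients first, then take the largest index among the
   minimizers. *)
have [j fj minj] := @arg_minP _ _ _ (Ordinal (sz _ fi0))
  (fun i : 'I_(tpoly_size f) => tcoef f i != 0) (fun i : 'I_(tpoly_size f) => V i) fi0.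
have [m /andP[fm /eqP Vm] maxm] := @arg_maxnP _ j
  (fun i : 'I_(tpoly_size f) => (tcoef f i != 0) && (V i == V j)) val (introT andP (conj fj (eqxx _))).
exists (V j), m; split=> //.
- move=> i; rewrite /vge; have [//|fi] /= := eqVneq.
  by have := minj (Ordinal (sz _ fi)) fi; rewrite /V /=; lra.
- by rewrite -Vm /V; lra.
move=> i lt_mi; rewrite /vgt; have [//|fi] /= := eqVneq.
have := minj (Ordinal (sz _ fi)) fi; rewrite /= le_eqVlt => /orP[/eqP e|].
  have := maxm (Ordinal (sz _ fi)); rewrite /= fi -e eqxx => /(_ isT) /=.
  by rewrite leqNgt lt_mi.
by rewrite /V; lra.
Qed.

Lemma gauss_ge_exists f z : exists c : R, gauss_ge f z c.
Proof.
have [->|f0] := eqVneq f 0; first by exists 0; apply: gauss_ge0.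
by have [c [m h]] := gauss_eq_exists z f0; exists c; apply: geq_ge h.
Qed.

(** * Right division, exact and approximate *)

(* No cancellation: the top index of [c * f] is at least [m], out of reach of [r]. *)
Lemma gauss_ge_split f z x m c r (B : R) :
  gauss_eq f z x m -> (forall i, (m <= i)%N -> tcoef r i = 0) ->
  gauss_ge (c * f + r) z B -> gauss_ge c x B /\ gauss_ge r z B.
Proof.
move=> hf hr hB; have hc : gauss_ge c x B.
  have [->|c0] := eqVneq c 0; first exact: gauss_ge0.
  have [B' [k hc]] := gauss_eq_exists x c0.
  have hcf := gauss_eqM hc hf.
  suff : B <= B' by move/gauss_ge_le; apply; apply: geq_ge hc.
  have := hB (k + m)%N; rewrite tcoefD hr ?leq_addl // addr0.
  by rewrite /vge (negPf (geq_neq0 hcf)) (geq_val hcf) /=; lra.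
split=> //; have -> : r = c * f + r - c * f by rewrite addrAC subrr add0r.
by apply: gauss_geD => //; apply: gauss_geN; apply: gauss_geM (geq_ge hf).
Qed.

(** With the divisor on the right, only a [q]-power of its leading coefficient has to be inverted,
    so no roots are extracted. *)
Lemma tdivision f m h :
  tcoef f m != 0 -> (forall i, (m < i)%N -> tcoef f i = 0) ->
  exists c r, (forall i, (m <= i)%N -> tcoef r i = 0) /\ h = c * f + r.
Proof.
move=> fm fgt; have: forall i, (tpoly_size h <= i)%N -> tcoef h i = 0.
  by move=> i; apply: tcoef_default.
move: (tpoly_size h) => N; elim: N h => [|N IHN] h hN.
  by exists 0, h; rewrite mul0r add0r; split=> // i _; apply: hN.
case: (ltnP N m) => [ltNm|leNm].
  exists 0, h; rewrite mul0r add0r; split=> // i lei; apply: hN.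
  exact: leq_trans lei.
pose c0 := tmono (tcoef h N / tcoef f m ^+ (#|K| ^ (N - m))) (N - m).
have [] := IHN (h - c0 * f).
  move=> i leNi; rewrite tcoefB tcoef_monoM; last by lia.
  have [eNi|ltNi] := eqVneq N i.
    by rewrite -eNi subKn // mulfVK ?subrr // expf_neq0.
  have lt_m : (m < i - (N - m))%N by move: leNi ltNi leNm; clear; lia.
  have lt_Ni : (N < i)%N by rewrite ltn_neqAle ltNi.
  rewrite (hN _ lt_Ni) (fgt _ lt_m).
  by rewrite expr_cardX_0 mulr0 subr0.
move=> c [r [hr e]]; exists (c0 + c), r; split=> //.
by rewrite mulrDl -addrA -e addrC subrK.
Qed.

(** Divide exactly by the truncation [f1] of [f] at degree [m]. The error is [- c (f - f1)], and the
    tail [f - f1] lives in indices above [m], so its value at [z] exceeds [x] by a margin [d]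
    independent of [h]. *)
Lemma weierstrass_step f z x m :
  gauss_eq f z x m -> exists2 d : R, 0 < d & forall h B, gauss_ge h z B ->
  exists c r, (forall i, (m <= i)%N -> tcoef r i = 0) /\
    gauss_ge (h - c * f - r) z (B + d).
Proof.
move=> hf; pose f1 : tpoly iota := \poly_(i < m.+1) tcoef f i.
have f1E i : tcoef f1 i = if (i <= m)%N then tcoef f i else 0.
  by rewrite /tcoef coef_poly ltnS.
have hf1 : gauss_eq f1 z x m.
  split; rewrite ?f1E ?leqnn ?(geq_neq0 hf) ?(geq_val hf) //.
    by move=> i; rewrite f1E; case: leqP => _; [apply: (geq_ge hf)|apply: vge0].
  by move=> i lt_mi; rewrite f1E leqNgt lt_mi vgt0.
have [d d0 hd] : exists2 d : R, 0 < d & gauss_ge (f - f1) z (x + d).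
  have [->|t0] := eqVneq (f - f1) 0; first by exists 1 => //; apply: gauss_ge0.
  have [x' [k hk]] := gauss_eq_exists z t0; exists (x' - x); last first.
    by apply: gauss_ge_le (geq_ge hk); lra.
  have := geq_neq0 hk; have := geq_val hk; rewrite tcoefB f1E.
  case: (leqP k m) => [_|ltmk]; first by rewrite subrr eqxx.
  rewrite subr0 => e k0; have := geq_gt hf ltmk.
  by rewrite /vgt (negPf k0) e /=; lra.
exists d => // h B hB.
have [|c [r [hr hE]]] := tdivision (m := m) (f := f1) h (geq_neq0 hf1).
  by move=> i lt_mi; rewrite f1E leqNgt lt_mi.
have [hc _] : gauss_ge c x B /\ gauss_ge r z B.
  by apply: (gauss_ge_split hf1) => //; rewrite -hE.
exists c, r; split=> //.
have -> : h - c * f - r = - (c * (f - f1)).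
  by rewrite hE mulrBr opprB addrAC addrK.
(* Moving the argument of [c] from [x] to [x + d] gains [q^i d >= d] at index [i]. *)
apply: gauss_geN; apply: gauss_geM hd => i; apply: vge_le (hc i).
by have := q_ge1 i; nra.
Qed.

(* Without completeness of [F], Weierstrass division by [f] on the disc of radius
   [z] only holds up to an arbitrarily small error. *)
Lemma weierstrass_approx f z x m h (B : R) :
  gauss_eq f z x m ->
  exists c r, (forall i, (m <= i)%N -> tcoef r i = 0) /\
    gauss_ge (h - c * f - r) z B.
Proof.
move=> hf; have [d d0 step] := weierstrass_step hf.
have [B0 hB0] := gauss_ge_exists h z.
suff [c [r [hr hN]]] : exists c r, (forall i, (m <= i)%N -> tcoef r i = 0) /\
    gauss_ge (h - c * f - r) z (B0 + (Num.bound ((B - B0) / d))%:R * d).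
  exists c, r; split=> //; apply: gauss_ge_le hN.
  rewrite -lerBlDl -ler_pdivrMr //; case: (leP 0 ((B - B0) / d)) => h0.
    by apply: ltW; apply: archi_boundP.
  exact: le_trans (ltW h0) (ler0n _ _).
elim: (Num.bound _) => [|N [c [r [hr hN]]]].
  exists 0, 0; split=> [i _|]; first exact: tcoef0.
  by rewrite !mul0r !subr0 addr0.
have [c' [r' [hr' hN']]] := step _ _ hN.
exists (c + c'), (r + r'); split=> [i lei|].
  by rewrite tcoefD hr // hr' // addr0.
have -> : h - (c + c') * f - (r + r') = h - c * f - r - c' * f - r'.
  by rewrite mulrDl !opprD !addrA; congr (_ - _); rewrite [RHS]addrAC.
by apply: gauss_ge_le hN'; rewrite -addn1 natrD; lra.
Qed.

(** * Comparison of attained indices in the coprime case *)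

Lemma linear_dependence m n (S : 'I_m -> nat -> F) : (n < m)%N ->
  exists2 t : 'I_m -> F, exists e, t e != 0 &
    forall j, (j < n)%N -> \sum_(e < m) t e * S e j = 0.
Proof.
move=> lt_nm; pose M := \matrix_(e < m, j < n) S e j.
have kM : kermx M != 0.
  rewrite kermx_eq0 -row_leq_rank -ltnNge.
  exact: leq_ltn_trans (rank_leq_col M) lt_nm.
pose t := nz_row (kermx M); have t0 : t != 0 by rewrite nz_row_eq0.
have tM : t *m M = 0 by apply/sub_kermxP/nz_row_sub.
exists (t 0); first by apply/rV0Pn.
move=> j lt_jn; have /matrixP/(_ 0 (Ordinal lt_jn)) := tM.
by rewrite !mxE => e; rewrite -[RHS]e; apply: eq_bigr => i _; rewrite mxE.
Qed.

Lemma attained_index_le f g a b u v z x y s m n k :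
  gauss_eq f z x m -> gauss_eq g z y n -> gauss_eq a y s k ->
  a * g = b * f -> u * f + v * g = 1 -> (m <= k)%N.
Proof.
move=> hf hg ha eab euv; rewrite leqNgt; apply/negP => lt_km.
(* Here [q e * z] is the value of [tau ^+ e] at [z]; the extra 1 is what yields the
   contradiction. *)
have : forall e : 'I_m, exists cr : tpoly iota * tpoly iota,
    (forall i, (k <= i)%N -> tcoef cr.2 i = 0) /\
    gauss_ge (tmono 1 e * v - cr.1 * a - cr.2) y (q e * z + 1).
  move=> e; have [c [r [hr hE]]] :=
    weierstrass_approx (tmono 1 e * v) (q e * z + 1) ha.
  by exists (c, r).
case/fin_all_exists => cr hcr.
(* The [m] remainders have only [k < m] coefficients each. Scalars acting on the left are not
   twisted, so ordinary linear algebra applies. *)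
have [t [e0 te0] ht] := linear_dependence (fun e j => tcoef (cr e).2 j) lt_km.
pose h : tpoly iota := \sum_(e < m) tmono (t e) e.
have hE i : tcoef h i = if insub i is Some e then t e else 0.
  rewrite tcoef_sum; case: insubP => [e _ <-|lei].
    rewrite (bigD1 e) //= tcoef_mono eqxx big1 ?addr0 // => e'.
    by rewrite -val_eqE tcoef_mono /= eq_sym => /negPf->.
  rewrite big1 // => e _; rewrite tcoef_mono; case: eqP => // ie.
  by rewrite ie ltn_ord in lei.
have h0 : h != 0.
  by apply: contraNneq te0 => /(congr1 (fun p : tpoly iota => tcoef p e0)); rewrite hE tcoef0 valK => ->.
have [B [j hB]] := gauss_eq_exists z h0.
pose E : tpoly iota :=
  \sum_(e < m) tmono (t e) 0 * ((tmono 1 e * v - (cr e).1 * a - (cr e).2) * g).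
have hEB : gauss_ge E z (B + 1).
  apply: gauss_ge_sum => e _.
  apply: (gauss_geM (x := q e * z + 1)); last first.
    by apply: gauss_geM (geq_ge hg); apply: (hcr e).2.
  move=> i; rewrite tcoef_mono; case: eqP => [->|_]; last exact: vge0.
  have := geq_ge hB e; rewrite hE valK expr0 mul1r.
  by apply: vge_le; lra.
(* Since [v g = 1 - u f] and [a g = b f], the total error [E] is [h - P f] up to the combined
   remainders times [g], which vanish. *)
pose P : tpoly iota :=
  \sum_(e < m) tmono (t e) 0 * (tmono 1 e * u + (cr e).1 * b).
have EP : E = - P * f + h.
  have r0 : \sum_(e < m) tmono (t e) 0 * (cr e).2 = 0 :> tpoly iota.
    apply/tcoefP => i; rewrite tcoef_sum tcoef0.
    have [lt_ik|le_ki] := ltnP i k.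
      rewrite -[RHS](ht i lt_ik); apply: eq_bigr => e _.
      by rewrite tcoef_monoM // subn0 expn0 expr1.
    rewrite big1 // => e _.
    by rewrite tcoef_monoM // (hcr e).1 ?subn0 // expr_cardX_0 mulr0.
  suff: E = h - P * f - (\sum_(e < m) tmono (t e) 0 * (cr e).2) * g.
    by rewrite r0 mul0r subr0 mulNr addrC.
  rewrite !mulr_suml -!sumrB; apply: eq_bigr => e _.
  have -> : tmono (t e) e = tmono (t e) 0 * (tmono 1 e * (u * f + v * g)).
    rewrite euv mulr1; apply/tcoefP => i; rewrite tcoef_monoM // subn0 !tcoef_mono.
    by rewrite expn0 expr1; case: eqP => _; rewrite ?mulr1 ?mulr0.
  rewrite -!mulrA -!mulrBr; congr (_ * _).
  rewrite !mulrBl mulrDl mulrDr -!mulrA eab !mulrA.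
  by rewrite opprD addrACA subrr add0r.
(* As [h] has degree below [m], it cannot cancel against a multiple of [f]: the bound [B + 1] on [E]
   passes to [h], whose value is [B]. *)
have [] := gauss_ge_split (c := - P) (r := h) (B := B + 1) hf.
- move=> i le_mi; rewrite hE; case: insubP => // e; rewrite ltnNge le_mi //.
- by rewrite -EP.
by move=> _ /(gauss_eq_le hB); lra.
Qed.

Lemma attained_index_lcm f g l a b u v z x y s m n k :
  gauss_eq f z x m -> gauss_eq g z y n -> gauss_eq l z s k ->
  l = a * g -> l = b * f -> u * f + v * g = 1 -> (m + n <= k)%N.
Proof.
move=> hf hg hl ea eb euv; have a0 : a != 0.
  apply: contraTneq (geq_neq0 hl) => a0.
  by rewrite ea a0 mul0r tcoef0 eqxx.
have [s' [k' ha]] := gauss_eq_exists y a0.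
have := gauss_eqM ha hg; rewrite -ea => /(gauss_eq_uniq hl)[_ ->].
rewrite leq_add2r; apply: (attained_index_le hf hg ha _ euv).
by rewrite -ea eb.
Qed.

(** * Normalized polynomials and descent in [z] *)

Lemma normalized_neq0 f : normalized f -> f != 0.
Proof.
by move=> f1; apply: contraTneq (oner_neq0 F) => f0; rewrite -f1 f0 tcoef0 eqxx.
Qed.

Lemma normalized_le f z x m : normalized f -> gauss_eq f z x m -> x <= z.
Proof.
move=> f1 hf; have := geq_ge hf 0; rewrite f1 /vge (negPf (oner_neq0 F)) w1 //=.
by rewrite expr0 mul1r subr_le0.
Qed.

(** If [C] bounds all coefficient values from below, then [z >= 0] and [z >= - C] give
    [q^(i+1) z >= 2 z >= z - C], so the constant term dominates. *)
Lemma normalized_ge f : normalized f ->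
  exists B : R, forall z x m, B <= z -> gauss_eq f z x m -> z <= x.
Proof.
move=> f1; have [C hC] := gauss_ge_exists f 0.
exists (Num.max 0 (- C)) => z x m; rewrite ge_max => /andP[z0 Cz] hf.
suff hz : gauss_ge f z z by apply: gauss_eq_le hf hz.
case=> [|i].
  by rewrite f1 /vge w1 // expr0 mul1r subrr lexx orbT.
apply: vge_le (hC i.+1); rewrite mulr0 subr0 exprS.
have := q_ge1 i; have : 2 <= #|K|%:R :> R by rewrite ler_nat card_finNzRing_gt1.
move=> K2 qi; have : 2 * z <= #|K|%:R * q i * z.
  by apply: ler_wpM2r => //; nra.
lra.
Qed.

(** At each of the two points, the line attained at the other one bounds the minimum from above. *)
Lemma gauss_eq_shift f z d x x' m m' :
  gauss_eq f z x m -> gauss_eq f (z + d) x' m' ->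
  x' - q m * d <= x /\ x <= x' - q m' * d.
Proof.
move=> h h'; split.
  have := geq_ge h' m; rewrite /vge (negPf (geq_neq0 h)) (geq_val h) /=; lra.
have := geq_ge h m'; rewrite /vge (negPf (geq_neq0 h')) (geq_val h') /=; lra.
Qed.

(* The slope on the left of a breakpoint is [q ^ m], and
   [q ^ (m + n) >= q ^ m + q ^ n - 1] says that [V_f + V_g - V_l - z] decreases in
   [z]. Going down by steps of size [d], the errors telescope to
   [d * (q ^ m + q ^ n)]. *)
Lemma coprime_step_bound f g l a b u v d N B z x y s m n k :
  normalized f -> normalized g -> normalized l ->
  l = a * g -> l = b * f -> u * f + v * g = 1 -> 0 <= d ->
  (forall z x m, B <= z -> gauss_eq f z x m -> z <= x) ->
  (forall z x m, B <= z -> gauss_eq g z x m -> z <= x) ->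
  B <= z + N%:R * d ->
  gauss_eq f z x m -> gauss_eq g z y n -> gauss_eq l z s k ->
  z + s <= x + y + d * (q m + q n).
Proof.
move=> f1 g1 l1 ea eb euv d0 Bf Bg.
elim: N z x y s m n k => [|N IHN] z x y s m n k hB hf hg hl.
  (* Beyond [B] both [x] and [y] are at least [z], while [s <= z] always holds. *)
  rewrite mul0r addr0 in hB; have := Bf _ _ _ hB hf; have := Bg _ _ _ hB hg.
  have := normalized_le l1 hl; have := q_gt0 m; have := q_gt0 n; nra.
have [x' [m' hf']] := gauss_eq_exists (z + d) (normalized_neq0 f1).
have [y' [n' hg']] := gauss_eq_exists (z + d) (normalized_neq0 g1).
have [s' [k' hl']] := gauss_eq_exists (z + d) (normalized_neq0 l1).
have hB' : B <= z + d + N%:R * d by move: hB; rewrite -addn1 natrD; lra.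
have := IHN _ _ _ _ _ _ _ hB' hf' hg' hl'.
have [hx _] := gauss_eq_shift hf hf'; have [hy _] := gauss_eq_shift hg hg'.
have [_ hs] := gauss_eq_shift hl hl'.
have : q m' + q n' - 1 <= q k'.
  apply: le_trans (_ : q (m' + n') <= _); last first.
    rewrite ler_weXn2l ?(attained_index_lcm hf' hg' hl' ea eb euv) //.
    exact: ltW cardK_gt1.
  (* This is [(q^m' - 1) (q^n' - 1) >= 0]. *)
  by rewrite exprD; have := q_ge1 m'; have := q_ge1 n'; nra.
(* Going down by [d], [z + s] falls by at least [d (1 + q^k')], which absorbs the error
   [d (q^m' + q^n')] inherited from [z + d]; the new error bounds the fall of [x + y]. *)
by move=> hq IH; nra.
Qed.

Lemma coprime_bound f g l a b u v z x y s m n k :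
  normalized f -> normalized g -> normalized l ->
  l = a * g -> l = b * f -> u * f + v * g = 1 ->
  gauss_eq f z x m -> gauss_eq g z y n -> gauss_eq l z s k ->
  z + s <= x + y.
Proof.
move=> f1 g1 l1 ea eb euv hf hg hl; rewrite leNgt; apply/negP => lt_xy.
have [Bf hBf] := normalized_ge f1; have [Bg hBg] := normalized_ge g1.
pose B := Num.max Bf Bg.
have hBf' z' x' m' : B <= z' -> gauss_eq f z' x' m' -> z' <= x'.
  by rewrite ge_max => /andP[h _]; apply: hBf.
have hBg' z' x' m' : B <= z' -> gauss_eq g z' x' m' -> z' <= x'.
  by rewrite ge_max => /andP[_ h]; apply: hBg.
have Q0 : 0 < q m + q n by rewrite addr_gt0 ?q_gt0.
(* With this step size the accumulated error is half the assumed excess. *)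
pose d := (z + s - (x + y)) / (q m + q n) / 2.
have dE : d * (q m + q n) = (z + s - (x + y)) / 2.
  by rewrite /d; field; rewrite gt_eqF.
have d0 : 0 < d by rewrite -(pmulr_lgt0 _ Q0) dE; lra.
have hB : B <= z + (Num.bound ((B - z) / d))%:R * d.
  rewrite -lerBlDl -ler_pdivrMr //; case: (leP 0 ((B - z) / d)) => h0.
    by apply: ltW; apply: archi_boundP.
  exact: le_trans (ltW h0) (ler0n _ _).
have := coprime_step_bound f1 g1 l1 ea eb euv (ltW d0) hBf' hBg' hB hf hg hl.
by rewrite dE; lra.
Qed.

(** * Cancellation and reduction to coprime polynomials *)

Lemma tmul_neq0 f g : f != 0 -> g != 0 -> f * g != 0.
Proof.
move=> f0 g0; have [x [n hg]] := gauss_eq_exists 0 g0.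
have [c [m hf]] := gauss_eq_exists x f0.
apply: contraTneq (geq_neq0 (gauss_eqM hf hg)) => fg0.
by rewrite fg0 tcoef0 eqxx.
Qed.

Lemma tmul_cancelr f g h : h != 0 -> f * h = g * h -> f = g.
Proof.
move=> h0 /eqP; rewrite -subr_eq0 -mulrBl => e; apply/eqP; rewrite -subr_eq0.
by apply: contraTT e => fg0; apply: tmul_neq0.
Qed.

Lemma normalized_divl f g : normalized g -> normalized (f * g) -> normalized f.
Proof.
rewrite /normalized tcoefM big_ord_recl big_ord0 addr0 subnn => ->.
by rewrite expr1n mulr1.
Qed.

(* Composing with [d] reduces to the coprime pair [f d^-1, g d^-1], since
   [V_(h d) = V_h \o V_d]. *)
Lemma gauss_gcd_lcm f g (d : tpoly iota) l z x y t s m n j k :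
  normalized f -> normalized g -> is_gcd f g d -> is_lcm f g l ->
  gauss_eq f z x m -> gauss_eq g z y n -> gauss_eq d z t j ->
  gauss_eq l z s k -> t + s <= x + y.
Proof.
move=> f1 g1 [d1 eI] [l1 eJ] hf hg hd hl.
have dI h : left_ideal d h <-> left_ideal_sum (left_ideal f) (left_ideal g) h.
  by rewrite eI.
have d0 := normalized_neq0 d1.
have [f' _ ef] : left_ideal d f.
  apply/dI; exists f; first by exists 1; rewrite ?mul1r.
  by exists 0; rewrite ?addr0 //; exists 0; rewrite ?mul0r.
have [g' _ eg] : left_ideal d g.
  apply/dI; exists 0; first by exists 0; rewrite ?mul0r.
  by exists g; rewrite ?add0r //; exists 1; rewrite ?mul1r.
have [_ [u _ <-] [_ [v _ <-] ed]] :
    left_ideal_sum (left_ideal f) (left_ideal g) d.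
  by apply/dI; exists 1; rewrite ?mul1r.
have [[b _ eb] [a _ ea]] : (left_ideal f `&` left_ideal g)%classic l.
  by rewrite -eJ; exists 1; rewrite ?mul1r.
have f'1 : normalized f' by apply: normalized_divl d1 _; rewrite ef.
have g'1 : normalized g' by apply: normalized_divl d1 _; rewrite eg.
have el : (b * f') * d = l by rewrite -mulrA ef eb.
have l'1 : normalized (b * f') by apply: normalized_divl d1 _; rewrite el.
have eab : b * f' = a * g'.
  by apply: (tmul_cancelr d0); rewrite el -mulrA eg ea.
have euv : u * f' + v * g' = 1.
  by apply: (tmul_cancelr d0); rewrite mulrDl -!mulrA ef eg ed mul1r.
(* Right multiplication by [d] evaluates the minimum of [h'] at the value [t] of [d], so the
   quotients at [t] have the values of [f], [g], [l] at [z]. *)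
have red h h' x' i : normalized h' -> h' * d = h -> gauss_eq h z x' i ->
    exists i', gauss_eq h' t x' i'.
  move=> h'1 eh hh; have [x'' [i' hh']] := gauss_eq_exists t (normalized_neq0 h'1).
  have := gauss_eqM hh' hd; rewrite eh => /(gauss_eq_uniq hh)[-> _].
  by exists i'.
have [m' hf'] := red _ _ _ _ f'1 ef hf; have [n' hg'] := red _ _ _ _ g'1 eg hg.
have [k' hl'] := red _ _ _ _ l'1 el hl.
exact: coprime_bound f'1 g'1 l'1 eab erefl euv hf' hg' hl'.
Qed.

End GaussNorm.

(** * From the discrete valuation to a real-valued one *)

Section DiscreteValuation.
Variables (R : realType) (F : fieldType) (nu : F -> \bar int).
Hypothesis nuP : discrete_valuation nu.

(** [fine] turns the infinite value at 0 into a default 0, which the zero tests in [vge] and [vgt]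
    mask. *)
Definition real_of_valuation (x : F) : R := (fine (nu x))%:~R.

Lemma valuation_fin x : x != 0 -> nu x = ((fine (nu x))%:E)%E.
Proof.
move=> x0; have := dv_eqy nuP x; have := dv_neqNy nuP (x := x).
by case: (nu x) => [r|_ [/(_ erefl)/eqP]|] //=; rewrite (negPf x0).
Qed.

Lemma real_of_valuationP : real_valuation real_of_valuation.
Proof.
rewrite /real_of_valuation; split=> x y x0 y0.
  by rewrite (dv_mul nuP) (valuation_fin x0) (valuation_fin y0) /= intrD.
move=> xy0; have := dv_add nuP x y.
rewrite (valuation_fin x0) (valuation_fin y0) (valuation_fin xy0) /=.
by rewrite !ge_min !lee_fin !ler_int.
Qed.

Lemma Vmin_gauss_eq (K : finFieldType) (iota : {rmorphism K -> F})
    (f : tpoly iota) (z c : R) m :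
  gauss_eq real_of_valuation f z c m -> Vmin nu f z = c%:E.
Proof.
have val x (r : R) : x != 0 ->
    (er_map (intr : int -> R) (nu x) + r%:E)%E = (real_of_valuation x + r)%:E.
  by move=> x0; rewrite /real_of_valuation (valuation_fin x0).
move=> h; apply/le_anti/andP; split.
  have lt_m : (m < tpoly_size f)%N.
    by rewrite ltnNge; apply: contra (geq_neq0 h) => /tcoef_default ->.
  apply: le_trans (bigmin_le _ (Ordinal lt_m) _) _.
  by rewrite val ?(geq_neq0 h) //= (geq_val h) subrK.
apply: le_bigmin => [|i _]; first exact: leey.
have [fi0|fi0] := eqVneq (tcoef f i) 0.
  by rewrite fi0 (_ : nu 0 = +oo%E) ?leey //; apply/(dv_eqy nuP).
rewrite val // lee_fin.
by have := geq_ge h i; rewrite /vge (negPf fi0) /= lerBlDr.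
Qed.

End DiscreteValuation.

Theorem theorem3p3 (R : realType) (K : finFieldType) (F : fieldType)
    (iota : {rmorphism K -> F}) (nu : F -> \bar int)
    (f g d l : tpoly iota) :
  discrete_valuation nu ->
  normalized f -> normalized g ->
  is_gcd f g d -> is_lcm f g l ->
  forall z : R,
    (Vmin nu d z + Vmin nu l z <= Vmin nu f z + Vmin nu g z)%E.
Proof.
move=> nuP f1 g1 hd hl z; have wP := real_of_valuationP R nuP.
have ex (h : tpoly iota) : normalized h ->
    exists (c : R) m, gauss_eq (real_of_valuation R nu) h z c m.
  by move=> h1; apply: gauss_eq_exists; apply: normalized_neq0.
have [x [m ef]] := ex f f1; have [y [n eg]] := ex g g1.
have [t [j ed]] := ex d hd.1; have [s [k el]] := ex l hl.1.
rewrite (Vmin_gauss_eq nuP ef) (Vmin_gauss_eq nuP eg).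
rewrite (Vmin_gauss_eq nuP ed) (Vmin_gauss_eq nuP el) -!EFinD lee_fin.
exact: (gauss_gcd_lcm wP f1 g1 hd hl ef eg ed el).
Qed.
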